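(* Consider the additive growth curve model $Y=\sum_{i=1}^k X_i\Theta_i Z_i'+\mathcal E$ with orthogonal design matrices (as specified in the context), with mean $\mu=\sum_{i=1}^k X_i\Theta_iZ_i'$, and take $\widehat\Sigma(Y)$ as the first-stage estimator of $\Sigma$. Then: (1) The two-stage generalized least-squares estimator $\hat\mu(Y)$ of $\mu$ is $$\hat\mu(Y)=\sum_{i=1}^k P_{X_i}Y\,\widehat\Sigma^{-1}(Y)\bigl(P_{Z_i}\widehat\Sigma^{-1}(Y)P_{Z_i}\bigr)^+=\sum_{i=1}^k P_{X_i}YH_i(Y).$$ (2) For each $i\in\{1,\dots,k\}$, the two-stage generalized least-squares estimator $\widehat\Theta_i(Y)$ of $\Theta_i$ is $$\widehat\Theta_i(Y)=(X_i'X_i)^{-1}X_i'\,Y\,H_i(Y)\,Z_i(Z_i'Z_i)^{-1}.$$ (3) If the distribution of $\mathcal E$ is symmetric about the origin $\mathbf 0$, then $\hat\mu(Y)$ is an unbiased estimator of $\mu$; moreover, for each $i$, $\widehat\Theta_i(Y)$ is an unbiased estimator of $\Theta_i$.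
   Context: Model. $Y$ is an $n\times p$ random matrix of observations with $Y=\sum_{i=1}^kX_i\Theta_iZ_i'+\mathcal E$. For $1\le i\le k$, $X_i$ is a known $n\times m_i$ design matrix ($n>m_i$) of full rank $m_i$, $Z_i$ is a known $p\times q_i$ profile matrix ($p>q_i$) of full rank $q_i$, and $\Theta_i$ is an unknown $m_i\times q_i$ matrix of regression coefficients. The $n\times p$ error matrix $\mathcal E$ has a general continuous type distribution; its rows are independent and identically distributed with mean zero and common unknown $p\times p$ covariance matrix $\Sigma$. The design matrices satisfy $\operatorname{rank}(X_i)+p\le n$ for all $i$ and $X_i'X_j=\mathbf 0$ for all distinct $i,j$. Notation. $A'$ is the transpose, $A^+$ the Moore-Penrose inverse, $A^-$ a generalized inverse, $P_A=A(A'A)^-A'$ the orthogonal projection onto the column space of $A$. $\operatorname{vec}$ stacks the rows of a matrix one underneath another into a column vector. $\otimes$ is the Kronecker product. Quadratic estimator. $\widehat\Sigma(Y)=Y'WY$, $W=\frac1r\bigl(I-\sum_{i=1}^kP_{X_i}\bigr)$, $r=n-\sum_{i=1}^k\operatorname{rank}(X_i)$. The paper takes $\widehat\Sigma(Y)$ to be positive definite with probability one, so that $\widehat\Sigma^{-1}(Y)=(\widehat\Sigma(Y))^{-1}$ exists with probability one. $H_i(Y)=\widehat\Sigma^{-1}(Y)Z_i\bigl(Z_i'\widehat\Sigma^{-1}(Y)Z_i\bigr)^{-1}Z_i'=\widehat\Sigma^{-1}(Y)\bigl(P_{Z_i}\widehat\Sigma^{-1}(Y)P_{Z_i}\bigr)^+$.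 Two-stage GLS estimator. For a given covariance $\Sigma$, the generalized least-squares (GLS) estimator of $\mu$ is the matrix minimizing $\langle Y-\mu,Y-\mu\rangle$ over all $\mu$ of the form $\sum_{i=1}^kX_i\Theta_iZ_i'$, where $\langle w_1,w_2\rangle=\operatorname{vec}(w_2)'(I\otimes\Sigma)^{-1}\operatorname{vec}(w_1)$ for $n\times p$ matrices $w_1,w_2$. The two-stage GLS estimator $\hat\mu(Y)$ is obtained by replacing $\Sigma$ in this minimization by the first-stage estimator $\widehat\Sigma(Y)$; the two-stage GLS estimators $\widehat\Theta_1(Y),\dots,\widehat\Theta_k(Y)$ are the corresponding coefficient matrices, i.e. $\hat\mu(Y)=\sum_{i=1}^kX_i\widehat\Theta_i(Y)Z_i'$.
   Formalization: In (3), unbiasedness of each estimator is stated under the added assumption that this estimator is integrable (its expectation exists); the stated model assumptions alone do not guarantee this. *)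

(* Defs.v *)
From mathcomp Require Import all_boot all_order all_algebra.
From mathcomp Require Import mxtens.
From mathcomp Require Import all_classical all_reals all_analysis.

Set Implicit Arguments.
Unset Strict Implicit.
Unset Printing Implicit Defensive.

Import Order.TTheory GRing.Theory Num.Theory.
Import numFieldNormedType.Exports.

Local Open Scope classical_set_scope.
Local Open Scope ring_scope.

Section LinearAlgebra.
Context {R : realType}.

Definition posdefmx p (S : 'M[R]_p) : Prop :=
  S^T = S /\ forall x : 'cV[R]_p, x != 0 -> 0 < (x^T *m S *m x) 0 0.

Definition is_mpinv m n (A : 'M[R]_(m, n)) (B : 'M[R]_(n, m)) : Prop :=
  [/\ A *m B *m A = A, B *m A *m B = B,
      (A *m B)^T = A *m B & (B *m A)^T = B *m A].

(* Moore-Penrose inverse; the default 0 is never used, see [mpinvP].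
   (The library's [pinvmx] is a generalized inverse, but not this one.) *)
Definition mpinv m n (A : 'M[R]_(m, n)) : 'M[R]_(n, m) :=
  xget 0 [set B | is_mpinv A B].

Lemma gram_unit m n (F : 'M[R]_(m, n)) : row_free F -> F *m F^T \in unitmx.
Proof.
move=> freeF; rewrite -row_free_unit -kermx_eq0 -submx0.
apply/rV_subP => v /sub_kermxP vFF0.
suff vF0 : v *m F = 0 by rewrite submx0 -(mulmx_free_eq0 _ freeF) vF0.
have s0 : \sum_j (v *m F) 0 j ^+ 2 = 0.
  have : ((v *m F) *m (v *m F)^T) 0 0 = 0.
    by rewrite trmx_mul mulmxA -(mulmxA v) vFF0 mul0mx mxE.
  by rewrite mxE => {2}<-; apply: eq_bigr => j _; rewrite !mxE expr2.
apply/rowP => j; rewrite [RHS]mxE; apply/eqP; rewrite -sqrf_eq0; apply/eqP.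
by move/psumr_eq0P: s0; apply => // i _; exact: sqr_ge0.
Qed.

Lemma is_mpinv_factor m n r (C : 'M[R]_(m, r)) (F : 'M[R]_(r, n)) :
  C^T *m C \in unitmx -> F *m F^T \in unitmx ->
  is_mpinv (C *m F)
    (F^T *m invmx (F *m F^T) *m (invmx (C^T *m C) *m C^T)).
Proof.
move=> uC uF.
set G := F^T *m _ *m _.
have AB : C *m F *m G = C *m (invmx (C^T *m C) *m C^T).
  by rewrite /G !mulmxA -(mulmxA C F) -(mulmxA C (F *m F^T)) mulmxV// mulmx1.
have BA : G *m (C *m F) = F^T *m invmx (F *m F^T) *m F.
  by rewrite /G !mulmxA -(mulmxA _ C^T C) -(mulmxA _ (invmx _) (C^T *m C))
    mulVmx// mulmx1.
split.
- by rewrite AB !mulmxA -(mulmxA _ C^T C) -(mulmxA _ (invmx _) (C^T *m C))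
    mulVmx// mulmx1.
- by rewrite BA /G !mulmxA -(mulmxA _ F F^T) -(mulmxA _ (invmx _) (F *m F^T))
    mulVmx// mulmx1.
- by rewrite AB !trmx_mul trmx_inv trmx_mul !trmxK mulmxA.
- by rewrite BA !trmx_mul trmx_inv trmx_mul !trmxK mulmxA.
Qed.

Lemma mpinvP m n (A : 'M[R]_(m, n)) : is_mpinv A (mpinv A).
Proof.
apply: (@xgetPex _ 0 [set B | is_mpinv A B]).
have uF : row_base A *m (row_base A)^T \in unitmx.
  by apply: gram_unit; exact: row_base_free.
have uC : (col_base A)^T *m col_base A \in unitmx.
  rewrite -{2}(trmxK (col_base A)); apply: gram_unit.
  by rewrite /row_free mxrank_tr; exact: col_base_full.
by move: (is_mpinv_factor uC uF); rewrite mulmx_base => ?; eexists; eassumption.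
Qed.

Lemma mpinv_uniq m n (A : 'M[R]_(m, n)) (B C : 'M[R]_(n, m)) :
  is_mpinv A B -> is_mpinv A C -> B = C.
Proof.
move=> [ABA BAB sAB sBA] [ACA CAC sAC sCA].
have AB_AC : A *m B = A *m C.
  rewrite -{1}ACA -mulmxA -[LHS]trmxK trmx_mul sAB sAC.
  by rewrite mulmxA ABA sAC.
have BA_CA : B *m A = C *m A.
  by rewrite -sCA -{2}ABA -(mulmxA A B A) mulmxA trmx_mul sCA sBA -!mulmxA
    (mulmxA A C A) ACA.
by rewrite -BAB -CAC BA_CA -!mulmxA AB_AC.
Qed.

(* [pinvmx B] satisfies B *m pinvmx B *m B = B, so it serves as (A'A)^-. *)
Definition projmx m n (A : 'M[R]_(m, n)) : 'M[R]_m :=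
  A *m pinvmx (A^T *m A) *m A^T.

Definition vec n p (A : 'M[R]_(n, p)) : 'cV[R]_(n * p) := (mxvec A)^T.

Lemma index_allpairs (I J : eqType) (s : seq I) (t : seq J) i j :
  i \in s -> j \in t ->
  index (i, j) [seq (x, y) | x <- s, y <- t]
  = (index i s * size t + index j t)%N.
Proof.
move=> si jt; elim: s si => // x s IHs; rewrite allpairs_cons index_cat /=.
have [<- _|neq_xi] := eqVneq x i.
  by rewrite map_f// mul0n add0n index_map// => y y' [].
rewrite in_cons eq_sym (negbTE neq_xi) /= => /IHs ->.
have -> : (i, j) \in [seq (x, y) | y <- t] = false.
  by apply/mapP => -[y _ [ix]]; rewrite ix eqxx in neq_xi.
by rewrite size_map mulSn addnA.
Qed.

(* [vec] stacks rows, in the order used by the Kronecker product [tensmx]. *)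
Lemma mxvec_index_tens n p (i : 'I_n) (j : 'I_p) :
  mxvec_index i j = mxtens_index (i, j).
Proof.
apply: val_inj => /=.
rewrite /enum_rank enum_rank_in.unlock insubdK; last first.
  by rewrite unfold_in /= cardE index_mem mem_enum.
rewrite enumT unlock /= /prod_enum index_allpairs ?mem_enum//.
by rewrite !index_enum_ord size_enum_ord.
Qed.

Definition gls_ip n p (S : 'M[R]_p) (w1 w2 : 'M[R]_(n, p)) : R :=
  ((vec w2)^T *m invmx (tensmx (1%:M : 'M[R]_n) S) *m vec w1) 0 0.

End LinearAlgebra.

Section GrowthCurve.
Context {R : realType} {n p k : nat} {m q : 'I_k -> nat}.
Variables (X : forall i, 'M[R]_(n, m i)) (Z : forall i, 'M[R]_(p, q i)).

Definition gc_mean (Th : forall i, 'M[R]_(m i, q i)) : 'M[R]_(n, p) :=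
  \sum_(i < k) X i *m Th i *m (Z i)^T.

Definition is_gls (S : 'M[R]_p) (Y M : 'M[R]_(n, p)) : Prop :=
  (exists Th, M = gc_mean Th) /\
  (forall Th, gls_ip S (Y - M) (Y - M)
              <= gls_ip S (Y - gc_mean Th) (Y - gc_mean Th)).

Definition resid_df : nat := (n - \sum_(i < k) \rank (X i))%N.

Definition Sigma_hat (Y : 'M[R]_(n, p)) : 'M[R]_p :=
  Y^T *m (resid_df%:R^-1 *: (1%:M - \sum_(i < k) projmx (X i))) *m Y.

Definition two_stage_gls (Y M : 'M[R]_(n, p)) : Prop :=
  is_gls (Sigma_hat Y) Y M.

Definition two_stage_gls_coef (Y : 'M[R]_(n, p))
    (Th : forall i, 'M[R]_(m i, q i)) : Prop :=
  two_stage_gls Y (gc_mean Th).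

Definition Hmx (i : 'I_k) (Y : 'M[R]_(n, p)) : 'M[R]_p :=
  let S1 := invmx (Sigma_hat Y) in
  S1 *m Z i *m invmx ((Z i)^T *m S1 *m Z i) *m (Z i)^T.

End GrowthCurve.

Section RandomMatrices.
Context {R : realType}.

Definition mx_cylinder a b : set (set 'M[R]_(a, b)) :=
  [set B | exists i j (A : set R),
     measurable A /\ B = [set M : 'M[R]_(a, b) | A (M i j)]].

Definition mx_borel a b : set (set 'M[R]_(a, b)) := <<s @mx_cylinder a b >>.

(* Lebesgue integral over R^d of a nonnegative Borel function, as an iterated
   integral (Tonelli). *)
Fixpoint integral_rV (d : nat) : ('rV[R]_d -> \bar R) -> \bar R :=
  match d return ('rV[R]_d -> \bar R) -> \bar R with
  | 0 => fun f => f 0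
  | d'.+1 => fun f =>
      (\int[@lebesgue_measure R]_x
         integral_rV (fun v : 'rV[R]_d' => f (row_mx (x%:M : 'M[R]_1) v)))%E
  end.

Context {d : measure_display} {T : measurableType d} (P : probability T R).

Definition random_mx a b (U : T -> 'M[R]_(a, b)) : Prop :=
  forall i j, measurable_fun setT (fun w => U w i j).

Definition same_law a b (U V : T -> 'M[R]_(a, b)) : Prop :=
  forall B, mx_borel B -> P (U @^-1` B) = P (V @^-1` B).

Definition symmetric_law a b (U : T -> 'M[R]_(a, b)) : Prop :=
  same_law U (fun w => - U w).

(* The law has a density with respect to Lebesgue measure on R^(a * b). *)
Definition continuous_type a b (U : T -> 'M[R]_(a, b)) : Prop :=
  exists f : 'M[R]_(a, b) -> R,
    [/\ forall M, 0 <= f M,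
        forall A : set R, measurable A -> mx_borel (f @^-1` A) &
        forall B, mx_borel B ->
          P (U @^-1` B) =
          integral_rV (fun v => (f (vec_mx v) * \1_B (vec_mx v))%:E)].

(* The product rule for subfamilies follows by taking B i = setT. *)
Definition independent_rows a b (U : T -> 'M[R]_(a, b)) : Prop :=
  forall B : 'I_a -> set 'rV[R]_b, (forall i, mx_borel (B i)) ->
    P (\bigcap_i (fun w => row i (U w)) @^-1` B i) =
    (\prod_(i < a) P ((fun w => row i (U w)) @^-1` B i))%E.

Definition identically_distributed_rows a b (U : T -> 'M[R]_(a, b)) : Prop :=
  forall i j, same_law (fun w => row i (U w)) (fun w => row j (U w)).

Definition rows_mean_zero a b (U : T -> 'M[R]_(a, b)) : Prop :=
  forall i j, ('E_P[fun w => U w i j] = 0)%E.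

Definition rows_covariance a b (U : T -> 'M[R]_(a, b)) (S : 'M[R]_b) : Prop :=
  forall i,
    (forall j, (fun w => U w i j : R) \in Lfun P 2%:E) /\
    (forall j l, covariance P (fun w => U w i j) (fun w => U w i l)
                 = (S j l)%:E).

(* Existence of the expectation: outside [Lfun P 1] the value of ['E_P[_]] is a
   convention of the library (+oo - +oo = -oo), hence [unbiased] is meant to be
   used together with [integrable_mx]. *)
Definition integrable_mx a b (U : T -> 'M[R]_(a, b)) : Prop :=
  forall i j, (fun w => U w i j : R) \in Lfun P 1.

Definition unbiased a b (U : T -> 'M[R]_(a, b)) (M : 'M[R]_(a, b)) : Prop :=
  forall i j, ('E_P[fun w => U w i j] = (M i j)%:E)%E.

End RandomMatrices.

(* Main.v *)
Require Import Defs.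
From mathcomp Require Import all_boot all_order all_algebra.
From mathcomp Require Import mxtens.
From mathcomp Require Import all_classical all_reals all_analysis.
From mathcomp Require Import measurable_realfun.

(** Why the theorem is true.

   Let S be a positive definite p x p matrix. The GLS criterion is the squared
   norm of Y - mu for the inner product tr(w2 S^-1 w1^T) ([gls_ipE]), so its
   minimizer over the linear space of the means is the orthogonal projection of
   Y, which the normal equations X_i^T (Y - mu) S^-1 Z_i = 0 characterize
   ([gls_normal_equations], by Pythagoras). Because X_i^T X_j = 0 for distinct
   i and j, these equations decouple into one equation for each i, solved by
   X_i Theta_i Z_i^T = P_(X_i) Y H_i with
   H_i = S^-1 Z_i (Z_i^T S^-1 Z_i)^-1 Z_i^T, the oblique projector [gls_proj]
   ([is_glsP]). As the X_i and Z_i have full column rank, the coefficients can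
   be read off from the mean ([gc_meanK]). The form with the Moore-Penrose
   inverse comes from checking the four Penrose identities ([gls_projE]).
   Taking S to be the estimated covariance gives the two closed formulas at
   every outcome where that estimate is positive definite.

   Unbiasedness is a symmetry argument. The estimated covariance sees only the
   errors and is even in them ([Sigma_hat_invariant], [Sigma_hatN]). Hence the
   estimated coefficients are the true ones plus an odd function of the errors
   ([two_stage_coef_equivariant], [two_stage_coefN]). This odd function is
   Borel, as its entries are built from those of the errors by ring operations
   and inversions ([random_mx_two_stage_coef]). When the errors have a law
   symmetric about 0, so has any Borel odd function of them, and an integrable
   variable with a symmetric law has mean 0 ([unbiased_odd]). *)

Set Implicit Arguments.
Unset Strict Implicit.
Unset Printing Implicit Defensive.

Import Order.TTheory GRing.Theory Num.Theory.
Import numFieldNormedType.Exports.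

Local Open Scope classical_set_scope.
Local Open Scope ring_scope.

(** * Positive definite matrices and the GLS inner product *)

Section PositiveDefinite.
Context {R : realType}.

Lemma mulmx_colfree_inj m n r (A : 'M[R]_(m, n)) (B : 'M[R]_(n, r)) :
  \rank A = n -> A *m B = 0 -> B = 0.
Proof.
move=> rA AB0; apply: trmx_inj; rewrite trmx0; apply/eqP.
have freeA : row_free A^T by rewrite /row_free mxrank_tr rA.
by rewrite -(mulmx_free_eq0 _ freeA) -trmx_mul AB0 trmx0.
Qed.

Lemma gram_colfree_unit m n (A : 'M[R]_(m, n)) :
  \rank A = n -> A^T *m A \in unitmx.
Proof.
move=> rA; rewrite -{2}(trmxK A); apply: gram_unit.
by rewrite /row_free mxrank_tr rA.
Qed.

Lemma posdefmx_unit p (S : 'M[R]_p) : posdefmx S -> S \in unitmx.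
Proof.
move=> [_ pdS]; rewrite -row_free_unit -kermx_eq0 -submx0.
apply/rV_subP => v /sub_kermxP vS0; rewrite submx0; apply/eqP/trmx_inj.
rewrite trmx0; apply/eqP/negP => /negP /pdS.
by rewrite trmxK vS0 mul0mx mxE ltxx.
Qed.

Lemma posdefmx_inv p (S : 'M[R]_p) : posdefmx S -> posdefmx (invmx S).
Proof.
move=> pdS; have uS := posdefmx_unit pdS; case: pdS => symS pdS.
have symV : (invmx S)^T = invmx S by rewrite trmx_inv symS.
split=> // x x0.
have -> : x^T *m invmx S *m x = (invmx S *m x)^T *m S *m (invmx S *m x).
  by rewrite trmx_mul symV !mulmxA mulmxKV.
apply: pdS; apply: contra_neq x0 => Vx0.
by rewrite -(mulKVmx uS x) Vx0 mulmx0.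
Qed.

Lemma posdefmx_congr p q (S : 'M[R]_p) (A : 'M[R]_(p, q)) :
  posdefmx S -> \rank A = q -> posdefmx (A^T *m S *m A).
Proof.
move=> [symS pdS] rA; split=> [|x x0].
  by rewrite !trmx_mul trmxK symS mulmxA.
have -> : x^T *m (A^T *m S *m A) *m x = (A *m x)^T *m S *m (A *m x).
  by rewrite trmx_mul !mulmxA.
by apply: pdS; apply: contra_neq x0; exact: mulmx_colfree_inj.
Qed.

Lemma projmxE m n (A : 'M[R]_(m, n)) :
  \rank A = n -> projmx A = A *m invmx (A^T *m A) *m A^T.
Proof. by move=> rA; rewrite /projmx pinvmxE// gram_colfree_unit. Qed.

Lemma trmx_projmx m n (A : 'M[R]_(m, n)) :
  \rank A = n -> (projmx A)^T = projmx A.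
Proof.
by move=> rA; rewrite projmxE// !trmx_mul trmx_inv trmx_mul !trmxK mulmxA.
Qed.

Lemma projmx_id m n (A : 'M[R]_(m, n)) : \rank A = n -> projmx A *m A = A.
Proof.
by move=> rA; rewrite projmxE// -!mulmxA mulVmx ?mulmx1// gram_colfree_unit.
Qed.

Lemma trmx_mul_projmx m n (A : 'M[R]_(m, n)) :
  \rank A = n -> A^T *m projmx A = A^T.
Proof. by move=> rA; rewrite -[projmx A]trmx_projmx// -trmx_mul projmx_id. Qed.

(** Turns a sum over the entries of a vectorized matrix into a double sum over
    rows and columns, the form in which Kronecker products can be evaluated. *)
Lemma sum_mxvec_index n p (F : 'I_(n * p) -> R) :
  \sum_ij F ij = \sum_(i < n) \sum_(j < p) F (mxvec_index i j).
Proof.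
rewrite (reindex _ (curry_mxvec_bij _ _)) /= pair_bigA.
by apply: eq_bigr => -[].
Qed.

(** [mxvec] lays out the rows one after the other, and the blocks of the
    Kronecker product with the identity act on each of them separately. *)
Lemma mxvec_mul_tens n p (w : 'M[R]_(n, p)) (A : 'M[R]_p) :
  mxvec w *m tensmx (1%:M : 'M[R]_n) A = mxvec (w *m A).
Proof.
apply/rowP => ij; case/mxvec_indexP: ij => i j.
rewrite mxvecE mxE sum_mxvec_index mxE (bigD1 i)//= [X in _ + X]big1 ?addr0.
  apply: eq_bigr => b _.
  by rewrite mxvecE !mxvec_index_tens tensmxE mxE eqxx mul1r.
move=> a ai; apply: big1 => b _.
by rewrite !mxvec_index_tens tensmxE mxE (negbTE ai) mul0r mulr0.
Qed.

(** Right multiplication by I (x) S is, through [mxvec], right multiplication of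
    the matrix by S; hence the inverse of I (x) S acts as that of S. *)
Lemma gls_ipE n p (S : 'M[R]_p) (w1 w2 : 'M[R]_(n, p)) : S \in unitmx ->
  gls_ip S w1 w2 = \tr (w2 *m invmx S *m w1^T).
Proof.
move=> uS; set T := tensmx (1%:M : 'M[R]_n) S.
(* I (x) S^-1 is a right inverse of T, tested on the rows of T. *)
have TV : T *m tensmx 1%:M (invmx S) = 1%:M.
  apply/row_matrixP => i; rewrite row_mul row1 rowE /T.
  by rewrite -(vec_mxK (delta_mx 0 i)) !mxvec_mul_tens -mulmxA mulmxV// mulmx1.
have uT : T \in unitmx by case: (mulmx1_unit TV).
have vecV : mxvec w2 *m invmx T = mxvec (w2 *m invmx S).
  rewrite -{1}(mulmxKV uS w2) -(mxvec_mul_tens (w2 *m _)) -/T.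
  by rewrite mulmxK.
rewrite /gls_ip /vec trmxK -/T vecV mxE sum_mxvec_index.
apply: eq_bigr => a _; rewrite [in RHS]mxE.
by apply: eq_bigr => b _; rewrite mxvecE !mxE -(mxvecE w1).
Qed.

Lemma gls_ip_pythagoras n p (S : 'M[R]_p) (u v : 'M[R]_(n, p)) :
  posdefmx S -> \tr (u *m invmx S *m v^T) = 0 ->
  gls_ip S (u + v) (u + v) = gls_ip S u u + gls_ip S v v.
Proof.
move=> pdS uv0; have uS := posdefmx_unit pdS.
have [symV _] := posdefmx_inv pdS.
have vu0 : \tr (v *m invmx S *m u^T) = 0.
  by rewrite -uv0 -[LHS]mxtrace_tr !trmx_mul trmxK symV mulmxA.
rewrite !gls_ipE// linearD/= !mulmxDl !mulmxDr !mxtraceD.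
by rewrite uv0 vu0 addr0 add0r.
Qed.

(** The trace is a sum over the rows of the quadratic form of S^-1, and one of
    these rows is nonzero. *)
Lemma gls_ip_gt0 n p (S : 'M[R]_p) (w : 'M[R]_(n, p)) :
  posdefmx S -> w != 0 -> 0 < gls_ip S w w.
Proof.
move=> pdS w0; rewrite gls_ipE ?posdefmx_unit//.
have [_ pdV] := posdefmx_inv pdS.
have rowE i : (w *m invmx S *m w^T) i i
    = ((row i w)^T^T *m invmx S *m (row i w)^T) 0 0.
  rewrite trmxK -row_mul [LHS]mxE [RHS]mxE.
  by apply: eq_bigr => j _; rewrite !mxE.
have ge0 i : true -> 0 <= (w *m invmx S *m w^T) i i.
  move=> _; rewrite rowE; have [->|ri0] := eqVneq (row i w) 0.
    by rewrite !trmx0 mulmx0 mxE.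
  by apply/ltW/pdV; rewrite trmx_eq0.
rewrite /mxtrace lt_neqAle sumr_ge0 // andbT eq_sym.
apply: contra_neq w0 => /(psumr_eq0P ge0) w0.
apply/row_matrixP => i; rewrite row0; apply/eqP; apply: contraT => ri0.
have := pdV (row i w)^T; rewrite -rowE w0// ltxx trmx_eq0.
by move=> /(_ ri0).
Qed.

End PositiveDefinite.
(** * Measurability of random matrices *)

Section RandomMatrixCalculus.
Context {R : realType} {d : measure_display} {T : measurableType d}.

Lemma measurable_invr : measurable_fun setT (@GRing.inv R).
Proof.
(* Real powers are measurable, and the factor x gives the right value 0 at 0. *)
have -> : @GRing.inv R = fun x => x * (x ^+ 2) `^ (-1).
  apply/funext => x; rewrite powR_inv1 ?sqr_ge0//.
  have [->|x0] := eqVneq x 0; first by rewrite invr0 mul0r.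
  by rewrite expr2 invfM mulrA divff// mul1r.
apply: measurable_funM; first exact: measurable_id.
exact: (measurableT_comp (measurable_powR (-1)) (@exprn_measurable _ _ 2)).
Qed.

Lemma random_mx_cst a b (A : 'M[R]_(a, b)) : random_mx (fun _ : T => A).
Proof. by move=> i j; exact: measurable_cst. Qed.

Lemma random_mx_tr a b (U : T -> 'M[R]_(a, b)) :
  random_mx U -> random_mx (fun w => (U w)^T).
Proof. by move=> mU i j; under eq_fun do rewrite mxE; exact: mU. Qed.

Lemma random_mx_sum a b (I : Type) (s : seq I) (U : I -> T -> 'M[R]_(a, b)) :
  (forall i, random_mx (U i)) -> random_mx (fun w => \sum_(i <- s) U i w).
Proof.
move=> mU i j; under eq_fun do rewrite summxE.
by apply: measurable_sum => l; exact: mU.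
Qed.

Lemma random_mxM a b c (U : T -> 'M[R]_(a, b)) (V : T -> 'M[R]_(b, c)) :
  random_mx U -> random_mx V -> random_mx (fun w => U w *m V w).
Proof.
move=> mU mV i j; under eq_fun do rewrite mxE.
by apply: measurable_sum => l; exact: measurable_funM.
Qed.

Lemma random_mx_det a (U : T -> 'M[R]_a) :
  random_mx U -> measurable_fun setT (fun w => \det (U w)).
Proof.
move=> mU; apply: measurable_sum => s; apply: measurable_funM => //.
by apply: measurable_prod => i _; exact: mU.
Qed.

(** Cramer's rule where the determinant does not vanish; elsewhere [invmx]
    returns its argument. *)
Lemma random_mx_inv a (U : T -> 'M[R]_a) :
  random_mx U -> random_mx (fun w => invmx (U w)).
Proof.
move=> mU i j; have mdet := random_mx_det mU.
have -> : (fun w => invmx (U w) i j) = fun w => if \det (U w) == 0 then U w i j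
    else (\det (U w))^-1 * cofactor (U w) j i.
  apply/funext => w; rewrite /invmx unitmxE unitfE.
  by case: eqP => //= _; rewrite !mxE.
apply: measurable_fun_ifT; [exact: measurable_fun_eqr | exact: mU |].
apply: measurable_funM; first exact: measurableT_comp measurable_invr mdet.
apply: measurable_funM => //; apply: random_mx_det => k l.
by under eq_fun do rewrite !mxE; exact: mU.
Qed.

End RandomMatrixCalculus.

(** * Odd functions of a symmetric random matrix *)

Section SymmetricLaw.
Context {R : realType} {d : measure_display} {T : measurableType d}.
Variable P : probability T R.

(** Both expectations are the integral of the identity for the common law. *)
Lemma expectation_same_law (U V : T -> R) : U \in Lfun P 1 -> V \in Lfun P 1 ->
  (forall A, measurable A -> P (U @^-1` A) = P (V @^-1` A)) ->
  ('E_P[U] = 'E_P[V])%E.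
Proof.
move=> /Lfun1_integrable iU /Lfun1_integrable iV UV; rewrite unlock.
have mU : measurable_fun setT U by apply/measurable_EFinP; case/integrableP: iU.
have mV : measurable_fun setT V by apply/measurable_EFinP; case/integrableP: iV.
have mE : measurable_fun (setT : set R) (@EFin R) by exact/measurable_EFinP.
have := integral_pushforward mU mE iU measurableT.
have := integral_pushforward mV mE iV measurableT.
rewrite !preimage_setT /= => <- <-.
by apply: eq_measure_integral => A mA _; exact: UV.
Qed.

(** U and - U have the same expectation, which is finite. *)
Lemma expectation_symmetric (U : T -> R) : U \in Lfun P 1 ->
  (forall A, measurable A -> P (U @^-1` A) = P ((\- U) @^-1` A)) ->
  ('E_P[U] = 0)%E.
Proof.
move=> L1U symU; have L1N : (\- U) \in Lfun P 1 by rewrite rpredN.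
have := expectation_same_law L1U L1N symU.
have -> : (\- U) = (-1) \o* U by apply/funext => w /=; rewrite mulrN1.
rewrite expectationZl//; have := expectation_fin_num L1U.
case: ('E_P[U])%E => //= r _; rewrite -EFinM => -[] /eqP.
by rewrite mulN1r -addr_eq0 -mulr2n mulrn_eq0/= => /eqP ->.
Qed.

(** The matrices with their Borel sigma-algebra, as a measurable type: a Borel
    function of a matrix is then itself a random matrix, on this type. *)
Definition borel_mx a b : measurableType _ :=
  g_sigma_algebraType (@mx_cylinder R a b).

Lemma random_mx_id a b : random_mx (fun M : borel_mx a b => M : 'M[R]_(a, b)).
Proof.
move=> i j _ A mA; rewrite setTI.
by apply: sub_sigma_algebra; exists i, j, A.
Qed.

Lemma random_mx_comp a b a' b' (F : borel_mx a b -> 'M[R]_(a', b'))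
    (U : T -> 'M[R]_(a, b)) :
  random_mx F -> random_mx U -> random_mx (fun w => F (U w)).
Proof.
move=> mF mU i j; apply: (measurableT_comp (mF i j)).
apply: measurability => //.
move=> _ [_ [k [l [A [mA ->]]]] <-].
exact: (mU k l measurableT A mA).
Qed.

(** Integrability is asked of U only: it passes to F (E w), which differs from U
    by a constant almost surely and is measurable in its own right. *)
Lemma unbiased_odd a b a' b' (E : T -> 'M[R]_(a, b))
    (F : borel_mx a b -> 'M[R]_(a', b')) (U : T -> 'M[R]_(a', b'))
    (M : 'M[R]_(a', b')) :
  random_mx E -> symmetric_law P E ->
  random_mx F -> (forall D, F (- D) = - F D) ->
  {ae P, forall w, U w = M + F (E w)} ->
  integrable_mx P U -> unbiased P U M.
Proof.
move=> mE symE mF oddF UE iU i j.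
pose V w := F (E w) i j.
have mV : measurable_fun setT V by exact: (random_mx_comp mF mE).
have /Lfun1_integrable iUij := iU i j.
have mUij : measurable_fun setT (fun w => U w i j).
  by apply/measurable_EFinP; case/integrableP: iUij.
have UV : ae_eq P setT (fun w => (U w i j)%:E) (fun w => (M i j + V w)%:E).
  by apply: filterS UE => w -> _; rewrite mxE.
have mMV : measurable_fun setT (fun w => M i j + V w) by exact: measurable_funD.
have L1MV : (fun w => M i j + V w) \in Lfun P 1.
  apply/Lfun1_integrable/integrableP; split; first exact/measurable_EFinP.
  case/integrableP: iUij => mU' /(le_lt_trans _); apply; rewrite le_eqVlt.
  apply/orP; left; apply/eqP; apply: ae_eq_integral => //.
  - by apply: measurableT_comp => //; exact/measurable_EFinP.
  - exact: measurableT_comp.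
  by apply: filterS UV => w eqUV _ /=; case: (eqUV I) => ->.
have L1V : V \in Lfun P 1.
  have -> : V = (fun w => M i j + V w) - cst (M i j).
    by apply/funext => w; rewrite /= addrAC subrr add0r.
  by rewrite rpredB// (Lfun_cst _ _ 1).
have EV : ('E_P[V] = 0)%E.
  apply: expectation_symmetric => // A mA.
  have := symE ((fun D => F D i j) @^-1` A).
  have -> : (\- V) @^-1` A =
      (fun w => - E w) @^-1` ((fun D => F D i j) @^-1` A).
    by apply/seteqP; split=> w; rewrite /= oddF mxE.
  by apply; have := mF i j measurableT A mA; rewrite setTI.
have -> : ('E_P[fun w => U w i j] = 'E_P[cst (M i j) \+ V])%E.
  rewrite unlock; apply: ae_eq_integral => //; exact/measurable_EFinP.
by rewrite expectationD// ?(Lfun_cst _ _ 1)// expectation_cst EV adde0.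
Qed.

End SymmetricLaw.

(** * The oblique projector of generalized least squares *)

Section GlsProjector.
Context {R : realType} {p q : nat} (S : 'M[R]_p) (Z : 'M[R]_(p, q)).
Hypotheses (pdS : posdefmx S) (rankZ : \rank Z = q).

(** Its transpose is the projector onto the column space of Z that is
    orthogonal for the inner product given by S^-1. With the estimated covariance
    for S it is convertible to [Hmx]. *)
Definition gls_proj : 'M[R]_p :=
  invmx S *m Z *m invmx (Z^T *m invmx S *m Z) *m Z^T.

Lemma gls_gram_unit : Z^T *m invmx S *m Z \in unitmx.
Proof. exact: posdefmx_unit (posdefmx_congr (posdefmx_inv pdS) rankZ). Qed.

Lemma trmx_mul_gls_proj : Z^T *m gls_proj = Z^T.
Proof. by rewrite /gls_proj !mulmxA mulmxV ?mul1mx// gls_gram_unit. Qed.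

Lemma gls_proj_mul : gls_proj *m invmx S *m Z = invmx S *m Z.
Proof.
by rewrite /gls_proj -!mulmxA (mulmxA Z^T) mulVmx ?mulmx1// gls_gram_unit.
Qed.

Lemma gls_proj_projmx : gls_proj *m projmx Z = gls_proj.
Proof.
by rewrite /gls_proj -[LHS]mulmxA trmx_mul_projmx.
Qed.

(** Let P be the orthogonal projector on the column space of Z, A = P S^-1 P and
    G = Z (Z^T S^-1 Z)^-1 Z^T. Both A G and G A equal P, which is symmetric and
    fixes A and G; so G satisfies the Penrose identities for A. *)
Lemma gls_projE :
  gls_proj = invmx S *m mpinv (projmx Z *m invmx S *m projmx Z).
Proof.
set G := Z *m invmx (Z^T *m invmx S *m Z) *m Z^T.
have HE : gls_proj = invmx S *m G by rewrite /gls_proj /G !mulmxA.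
have ZP := trmx_mul_projmx rankZ.
have PZ := projmx_id rankZ.
have GP : G *m projmx Z = G by rewrite /G -mulmxA ZP.
have PG : projmx Z *m G = G by rewrite /G !mulmxA PZ.
have PSG : projmx Z *m invmx S *m projmx Z *m G = projmx Z.
  rewrite -mulmxA PG -mulmxA -HE {1}projmxE// -mulmxA trmx_mul_gls_proj.
  by rewrite -projmxE.
have symG : G^T = G.
  have [symV _] := posdefmx_inv pdS.
  by rewrite /G !trmx_mul trmx_inv !trmx_mul !trmxK symV !mulmxA.
have symA : (projmx Z *m invmx S *m projmx Z)^T =
    projmx Z *m invmx S *m projmx Z.
  have [symV _] := posdefmx_inv pdS.
  by rewrite trmx_mul (trmx_mul (projmx Z)) trmx_projmx// symV mulmxA.
have GSP : G *m (projmx Z *m invmx S *m projmx Z) = projmx Z.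
  by rewrite -symG -symA -trmx_mul PSG trmx_projmx.
have PP : projmx Z *m projmx Z = projmx Z.
  by rewrite {2 3}projmxE// !mulmxA PZ.
rewrite HE; congr (_ *m _); apply: mpinv_uniq (mpinvP _); split.
- by rewrite PSG (mulmxA (projmx Z) (_ *m _)) (mulmxA (projmx Z) (projmx Z)) PP.
- by rewrite GSP PG.
- by rewrite PSG trmx_projmx.
- by rewrite GSP trmx_projmx.
Qed.

End GlsProjector.

(** * Generalized least squares in the growth curve model *)

Section GrowthCurveGls.
Context {R : realType} {n p k : nat} {m q : 'I_k -> nat}.
Variables (X : forall i, 'M[R]_(n, m i)) (Z : forall i, 'M[R]_(p, q i)).
Hypotheses (rankX : forall i, \rank (X i) = m i)
  (rankZ : forall i, \rank (Z i) = q i)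
  (orthX : forall i j, i != j -> (X i)^T *m X j = 0).

Implicit Types (Y M E : 'M[R]_(n, p)) (Th : forall i, 'M[R]_(m i, q i)).

Lemma gc_meanB Th1 Th2 :
  gc_mean X Z Th1 - gc_mean X Z Th2 = gc_mean X Z (fun i => Th1 i - Th2 i).
Proof.
rewrite /gc_mean -sumrB; apply: eq_bigr => i _.
by rewrite mulmxBr mulmxBl.
Qed.

Lemma gc_meanD Th1 Th2 :
  gc_mean X Z (fun i => Th1 i + Th2 i) = gc_mean X Z Th1 + gc_mean X Z Th2.
Proof.
rewrite /gc_mean -big_split; apply: eq_bigr => i _.
by rewrite mulmxDr mulmxDl.
Qed.

(** Orthogonality of the designs decouples the model: multiplication by X_i^T
    retains the i-th term alone. *)
Lemma trX_gc_mean Th i :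
  (X i)^T *m gc_mean X Z Th = (X i)^T *m X i *m Th i *m (Z i)^T.
Proof.
rewrite /gc_mean mulmx_sumr (bigD1 i)//= big1 ?addr0 ?mulmxA// => j ji.
by rewrite !mulmxA orthX ?mul0mx// eq_sym.
Qed.

(** The coefficients are identifiable, with an explicit linear left inverse of
    [gc_mean]. *)
Lemma gc_meanK Th i :
  invmx ((X i)^T *m X i) *m (X i)^T *m gc_mean X Z Th *m Z i *m
    invmx ((Z i)^T *m Z i) = Th i.
Proof.
rewrite -(mulmxA _ _ (gc_mean X Z Th)) trX_gc_mean.
rewrite -(mulmxA _ (Th i)) mulKmx ?gram_colfree_unit//.
by rewrite -!mulmxA (mulmxA (Z i)^T) mulmxV ?mulmx1// gram_colfree_unit.
Qed.

(** The equations say that the residual Y - mu0 is orthogonal to all means. By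
    Pythagoras the criterion at another mean mu exceeds its value at mu0 by the
    squared norm of mu0 - mu, so the minimizer exists and is unique. *)
Lemma gls_normal_equations (S : 'M[R]_p) Y Th0 : posdefmx S ->
  (forall i, (X i)^T *m (Y - gc_mean X Z Th0) *m invmx S *m Z i = 0) ->
  forall M, is_gls X Z S Y M <-> M = gc_mean X Z Th0.
Proof.
move=> pdS normal M; have uS := posdefmx_unit pdS.
set mu0 := gc_mean X Z Th0 in normal *.
have cross Th : \tr ((Y - mu0) *m invmx S *m (gc_mean X Z Th)^T) = 0.
  rewrite [X in _ *m X]linear_sum/= mulmx_sumr linear_sum/= big1// => i _.
  rewrite !trmx_mul trmxK !mulmxA mxtrace_mulC !mulmxA.
  by rewrite normal mul0mx mxtrace0.
have pythagoras Th : gls_ip S (Y - gc_mean X Z Th) (Y - gc_mean X Z Th)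
    = gls_ip S (Y - mu0) (Y - mu0)
      + gls_ip S (mu0 - gc_mean X Z Th) (mu0 - gc_mean X Z Th).
  have -> : Y - gc_mean X Z Th = (Y - mu0) + (mu0 - gc_mean X Z Th).
    by rewrite addrA subrK.
  by apply: gls_ip_pythagoras => //; rewrite gc_meanB; exact: cross.
have ge0 (w : 'M[R]_(n, p)) : 0 <= gls_ip S w w.
  have [->|w0] := eqVneq w 0; last exact/ltW/gls_ip_gt0.
  by rewrite gls_ipE// mul0mx mul0mx mxtrace0.
split=> [[[Th ->] /(_ Th0)]|->]; last first.
  by split=> [|Th]; [exists Th0 | rewrite pythagoras lerDl].
rewrite pythagoras -/mu0 gerDl => le0; apply/esym/eqP; rewrite -subr_eq0.
by apply: contraLR le0 => /(gls_ip_gt0 pdS); rewrite ltNge.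
Qed.

Definition gls_coef (S : 'M[R]_p) Y (i : 'I_k) : 'M[R]_(m i, q i) :=
  invmx ((X i)^T *m X i) *m (X i)^T *m Y *m gls_proj S (Z i) *m Z i *m
  invmx ((Z i)^T *m Z i).

(** H_i absorbs the factor Z_i (Z_i^T Z_i)^-1 Z_i^T on its right. *)
Lemma gc_mean_gls_coef (S : 'M[R]_p) Y : posdefmx S ->
  gc_mean X Z (gls_coef S Y)
  = \sum_(i < k) projmx (X i) *m Y *m gls_proj S (Z i).
Proof.
move=> pdS; apply: eq_bigr => i _; rewrite -[in RHS]gls_proj_projmx//.
by rewrite !projmxE// /gls_coef !mulmxA.
Qed.

(** The normal equation for i reads X_i^T Y S^-1 Z_i = X_i^T Y H_i S^-1 Z_i,
    which holds because H_i fixes S^-1 Z_i on its left ([gls_proj_mul]). *)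
Lemma is_glsP (S : 'M[R]_p) Y M : posdefmx S ->
  is_gls X Z S Y M <-> M = gc_mean X Z (gls_coef S Y).
Proof.
move=> pdS; apply: gls_normal_equations => // i.
rewrite mulmxBr gc_mean_gls_coef// mulmx_sumr (bigD1 i)//= big1 ?addr0.
  rewrite 2!(mulmxA (X i)^T) trmx_mul_projmx// !mulmxBl -[X in _ - X]mulmxA.
  rewrite -[X in _ - X]mulmxA (mulmxA (gls_proj _ _)) gls_proj_mul//.
  by rewrite !mulmxA subrr.
move=> j ji; rewrite (projmxE (rankX j)) !mulmxA.
by rewrite (orthX (i := i) (j := j)) ?mul0mx// eq_sym.
Qed.

Lemma sum_projmx_gc_mean Th :
  (\sum_(i < k) projmx (X i)) *m gc_mean X Z Th = gc_mean X Z Th.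
Proof.
rewrite mulmx_suml; apply: eq_bigr => i _.
rewrite projmxE// -mulmxA trX_gc_mean -(mulmxA _ (Th i)) -(mulmxA (X i)).
by rewrite mulKmx ?gram_colfree_unit// !mulmxA.
Qed.

(** The residual projector kills the mean, on either side as it is symmetric. *)
Lemma Sigma_hat_invariant Th E :
  Sigma_hat X (gc_mean X Z Th + E) = Sigma_hat X E.
Proof.
rewrite /Sigma_hat; set W := _ *: _.
have WM : W *m gc_mean X Z Th = 0.
  by rewrite -scalemxAl mulmxBl mul1mx sum_projmx_gc_mean subrr scaler0.
have symW : W^T = W.
  rewrite /W linearZ/= linearB/= trmx1 linear_sum/=; congr (_ *: (_ - _)).
  by apply: eq_bigr => i _; rewrite trmx_projmx.
rewrite mulmxDr -mulmxA WM mulmx0 add0r linearD/= mulmxDl.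
by rewrite -{1}symW -trmx_mul WM trmx0 add0r.
Qed.

Lemma Sigma_hatN E : Sigma_hat X (- E) = Sigma_hat X E.
Proof. by rewrite /Sigma_hat mulmxN [(- E)^T]linearN/= !mulNmx opprK. Qed.

Definition two_stage_coef Y := gls_coef (Sigma_hat X Y) Y.

(** The covariance estimate does not change with the mean, so the coefficients
    depend on the mean linearly, through Z_i^T H_i = Z_i^T. *)
Lemma two_stage_coef_equivariant Th E i : posdefmx (Sigma_hat X E) ->
  two_stage_coef (gc_mean X Z Th + E) i = Th i + two_stage_coef E i.
Proof.
move=> pdS; rewrite /two_stage_coef Sigma_hat_invariant /gls_coef.
rewrite mulmxDr !mulmxDl; congr (_ + _).
rewrite -[in RHS](gc_meanK Th i); do 2!congr (_ *m _).
rewrite -!(mulmxA _ (X i)^T) trX_gc_mean.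
by rewrite -(mulmxA (invmx _)) -(mulmxA (_ *m Th i)) trmx_mul_gls_proj.
Qed.

Lemma two_stage_coefN E i : two_stage_coef (- E) i = - two_stage_coef E i.
Proof. by rewrite /two_stage_coef Sigma_hatN /gls_coef mulmxN !mulNmx. Qed.

Lemma gc_meanN Th : gc_mean X Z (fun i => - Th i) = - gc_mean X Z Th.
Proof.
by rewrite /gc_mean -sumrN; apply: eq_bigr => i _; rewrite mulmxN mulNmx.
Qed.

Lemma random_mx_two_stage_coef i :
  random_mx (fun E : borel_mx (R:=R) n p => two_stage_coef E i).
Proof.
have mS : random_mx (fun E : borel_mx n p => invmx (Sigma_hat X E)).
  apply: random_mx_inv; apply: random_mxM; last exact: random_mx_id.
  apply: random_mxM; last exact: random_mx_cst.
  by apply: random_mx_tr; exact: random_mx_id.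
apply: random_mxM; last exact: random_mx_cst.
apply: random_mxM; last exact: random_mx_cst.
apply: random_mxM.
  by apply: random_mxM; [exact: random_mx_cst | exact: random_mx_id].
apply: random_mxM; last exact: random_mx_cst.
apply: random_mxM; first by apply: random_mxM => //; exact: random_mx_cst.
apply: random_mx_inv; apply: random_mxM; last exact: random_mx_cst.
by apply: random_mxM => //; exact: random_mx_cst.
Qed.

End GrowthCurveGls.

Theorem theorem2p1 (R : realType) (d : measure_display) (T : measurableType d)
    (P : probability T R)
    (n p k : nat) (m q : 'I_k -> nat)
    (X : forall i : 'I_k, 'M[R]_(n, m i)) (Z : forall i : 'I_k, 'M[R]_(p, q i))
    (Theta : forall i : 'I_k, 'M[R]_(m i, q i)) (Sigma : 'M[R]_p)
    (E Y : T -> 'M[R]_(n, p))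
    (k_gt0 : (0 < k)%N)
    (lt_m_n : forall i, (m i < n)%N) (rankX : forall i, \rank (X i) = m i)
    (lt_q_p : forall i, (q i < p)%N) (rankZ : forall i, \rank (Z i) = q i)
    (rankXp : forall i, (\rank (X i) + p <= n)%N)
    (orthX : forall i j, i != j -> (X i)^T *m X j = 0)
    (E_random : random_mx E)
    (E_continuous : continuous_type P E)
    (E_indep : independent_rows P E)
    (E_ident : identically_distributed_rows P E)
    (E_mean : rows_mean_zero P E)
    (E_cov : rows_covariance P E Sigma)
    (Y_model : forall w, Y w = gc_mean X Z Theta + E w)
    (Sigma_hat_pd : {ae P, forall w, posdefmx (Sigma_hat X (Y w))}) :
  [/\ {ae P, forall w,
        (forall M : 'M[R]_(n, p), two_stage_gls X Z (Y w) M <->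
          M = \sum_(i < k) projmx (X i) *m Y w *m invmx (Sigma_hat X (Y w)) *m
                mpinv (projmx (Z i) *m invmx (Sigma_hat X (Y w)) *m
                       projmx (Z i))) /\
        \sum_(i < k) projmx (X i) *m Y w *m invmx (Sigma_hat X (Y w)) *m
            mpinv (projmx (Z i) *m invmx (Sigma_hat X (Y w)) *m projmx (Z i))
        = \sum_(i < k) projmx (X i) *m Y w *m Hmx X Z i (Y w)},
      {ae P, forall w, forall Th : forall i : 'I_k, 'M[R]_(m i, q i),
        two_stage_gls_coef X Z (Y w) Th <->
        forall i, Th i =
          invmx ((X i)^T *m X i) *m (X i)^T *m Y w *m Hmx X Z i (Y w) *m Z i *m
          invmx ((Z i)^T *m Z i)} &
      symmetric_law P E ->
        (forall mu_hat : T -> 'M[R]_(n, p),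
           {ae P, forall w, two_stage_gls X Z (Y w) (mu_hat w)} ->
           integrable_mx P mu_hat ->
           unbiased P mu_hat (gc_mean X Z Theta)) /\
        (forall Theta_hat : T -> forall i : 'I_k, 'M[R]_(m i, q i),
           {ae P, forall w, two_stage_gls_coef X Z (Y w) (Theta_hat w)} ->
           forall i, integrable_mx P (fun w => Theta_hat w i) ->
             unbiased P (fun w => Theta_hat w i) (Theta i))].
Proof.
have mean_inj Th1 Th2 :
    gc_mean X Z Th1 = gc_mean X Z Th2 <-> forall i, Th1 i = Th2 i.
  split=> [eqTh i|eqTh]; last by apply: eq_bigr => i _; rewrite eqTh.
  by rewrite -[LHS](gc_meanK rankX rankZ orthX) eqTh gc_meanK.
have coefE w i : posdefmx (Sigma_hat X (Y w)) ->
    two_stage_coef X Z (Y w) i = Theta i + two_stage_coef X Z (E w) i.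
  by rewrite Y_model Sigma_hat_invariant//; exact: two_stage_coef_equivariant.
split.
- apply: filterS Sigma_hat_pd => w pdS.
  have HE : \sum_(i < k) projmx (X i) *m Y w *m invmx (Sigma_hat X (Y w)) *m
        mpinv (projmx (Z i) *m invmx (Sigma_hat X (Y w)) *m projmx (Z i))
      = \sum_(i < k) projmx (X i) *m Y w *m Hmx X Z i (Y w).
    apply: eq_bigr => i _.
    by rewrite -(mulmxA _ (invmx _)) -gls_projE.
  split=> // M; rewrite HE -gc_mean_gls_coef//.
  exact: is_glsP.
- apply: filterS Sigma_hat_pd => w pdS Th.
  by rewrite /two_stage_gls_coef /two_stage_gls is_glsP.
move=> symE; split=> [mu_hat mu_gls imu|Th_hat Th_gls i iTh].
- pose F D := gc_mean X Z (two_stage_coef X Z D).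
  apply: (unbiased_odd (F := F)) imu => //.
  + apply: random_mx_sum => i; apply: random_mxM; last exact: random_mx_cst.
    apply: random_mxM; first exact: random_mx_cst.
    exact: random_mx_two_stage_coef.
  + move=> D; rewrite /F -gc_meanN; apply/mean_inj => i.
    exact: two_stage_coefN.
  apply: filterS2 Sigma_hat_pd mu_gls => w pdS.
  rewrite /two_stage_gls is_glsP// => ->; rewrite /F -gc_meanD.
  by apply/mean_inj => i; exact: coefE.
- apply: (unbiased_odd (F := fun D => two_stage_coef X Z D i)) iTh => //.
  + exact: random_mx_two_stage_coef.
  + by move=> D; exact: two_stage_coefN.
  apply: filterS2 Sigma_hat_pd Th_gls => w pdS.
  rewrite /two_stage_gls_coef /two_stage_gls is_glsP// => /mean_inj ->.
  exact: coefE.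
Qed.
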